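(* Let $Y$ be a Poisson random variable with parameter $\alpha>0$, let $0<q<1$, $x\in[0,1]$, and let $n,r$ be integers with $0\le r\le n$. Then $$B_{r,n}^{Y}(x,q)=\sum_{m=0}^{n-r}\binom{n}{r}\alpha^{m}\,[x]_q^{r}\,\bigl(1-[x]_{q^{-1}}\bigr)^{m}\left\{{n-r\atop m}\right\}.$$
   Context: $q$-numbers: $[x]_q=\frac{q^x-1}{q-1}$ and $[x]_{q^{-1}}=\frac{q^{-x}-1}{q^{-1}-1}$; one has $[1-x]_q=1-[x]_{q^{-1}}$. Probabilistic $q$-Bernstein polynomials $B_{r,n}^Y(x,q)$ associated with $Y$: $\sum_{n=r}^{\infty}B_{r,n}^{Y}(x,q)\frac{v^n}{n!}=\frac{(v[x]_q)^r}{r!}\left(\mathrm{E}[e^{vY}]\right)^{[1-x]_q}$, where the power is the power series in $v$ with constant term $1$. For $Y\sim \mathrm{Poisson}(\alpha)$, $P(Y=y)=e^{-\alpha}\alpha^y/y!$ and $\mathrm{E}[e^{vY}]=e^{\alpha(e^v-1)}$. $\left\{{n\atop m}\right\}$ are the Stirling numbers of the second kind: $\sum_{n=m}^{\infty}\left\{{n\atop m}\right\}\frac{v^n}{n!}=\frac{(e^v-1)^m}{m!}$. *)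

(* Defs.v *)
From HB Require Import structures.
From mathcomp Require Import all_boot all_order all_algebra.
From mathcomp Require Import all_classical all_reals all_analysis.
Set Implicit Arguments.
Unset Strict Implicit.
Unset Printing Implicit Defensive.
Import Order.TTheory GRing.Theory Num.Theory.
Import numFieldNormedType.Exports.
Local Open Scope classical_set_scope.
Local Open Scope ring_scope.

(* [x]_q is [qnum q x] and [x]_{q^-1} is [qnum q^-1 x]. *)
Definition qnum (R : realType) (q x : R) : R := (q `^ x - 1) / (q - 1).

(* \sum_(n >= r) a_n v^n / n! = f v for all v in a neighbourhood of 0.
   The terms below r do not occur in the series; setting them to 0 makes a
   unique (identity theorem for power series). *)
Definition has_egf_from (R : realType) (r : nat) (a : nat -> R) (f : R -> R)
    : Prop :=
  (forall n : nat, (n < r)%N -> a n = 0) /\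
  \forall v \near (0 : R),
    (fun N : nat => \sum_(r <= n < N) a n * (v ^+ n / n`!%:R)) @ \oo --> f v.

(* The sequence (a_n) generated by f; the zero sequence if f has no such
   expansion. *)
Definition egf_coef (R : realType) (r : nat) (f : R -> R) : nat -> R :=
  xget (fun=> 0) [set a : nat -> R | has_egf_from r a f].

(* Valued in R because it is defined by the generating function. *)
Definition stirling2 (R : realType) (n m : nat) : R :=
  egf_coef m (fun v : R => (expR v - 1) ^+ m / m`!%:R) n.

(* Near v = 0 the moment generating function is close to its value 1 at 0, so
   the positive real power [`^] is the branch with constant term 1. [fine] is
   harmless where E[exp (vY)] is finite. *)
Definition prob_qBernstein (d : measure_display) (T : measurableType d)
    (R : realType) (P : probability T R) (Y : {RV P >-> R})
    (r n : nat) (x q : R) : R :=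
  egf_coef r (fun v : R =>
    (v * qnum q x) ^+ r / r`!%:R * (fine ('M_P Y v)) `^ (qnum q (1 - x))) n.

Definition is_poisson (d : measure_display) (T : measurableType d)
    (R : realType) (P : probability T R) (Y : {RV P >-> R}) (alpha : R)
    : Prop :=
  forall y : nat,
    P [set t | Y t = y%:R] = (expR (- alpha) * alpha ^+ y / y`!%:R)%:E.

(* Main.v *)
(* With beta = alpha [1-x]_q the generating function of the Bernstein
   polynomials of a Poisson variable is
   (v [x]_q)^r / r! * exp (beta (e^v - 1)). Expanding the exponential in powers
   of e^v - 1, and these in powers of v, gives a double series whose
   coefficients are the Touchard polynomials sum_m S(n, m) beta^m; replacing v
   and beta by their absolute values dominates it, since S(n, m) >= 0, so
   Tannery's theorem allows summing along v^n. Uniqueness of power series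
   coefficients then identifies both sides. *)
Require Import Defs.
From mathcomp Require Import all_boot all_order all_algebra.
From mathcomp Require Import all_classical all_reals all_analysis measurable_realfun.
From mathcomp Require Import ring lra.
Import Order.TTheory GRing.Theory Num.Theory.
Import numFieldNormedType.Exports.
Local Open Scope classical_set_scope.
Local Open Scope ring_scope.

(** * Limits of finite and dominated sums *)

Lemma cvg_seq_ext {R : realType} {u v : nat -> R} {l : R} :
  u @ \oo --> l -> u =1 v -> v @ \oo --> l.
Proof. by move=> ul /funext <-. Qed.

Lemma cvg_sum_seq {R : realType} {I : Type} (s : seq I) (f : I -> nat -> R)
    (l : I -> R) : (forall i, f i @ \oo --> l i) ->
  (fun N => \sum_(i <- s) f i N) @ \oo --> \sum_(i <- s) l i.
Proof.
move=> fl; elim: s => [|i s IH].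
  by rewrite big_nil; under eq_fun do rewrite big_nil; exact: cvg_cst.
by rewrite big_cons; under eq_fun do rewrite big_cons; exact: cvgD.
Qed.

(** Past a large [M] the terms of [u] and of [l] are both dominated by a small tail of [B]; below
    [M] only finitely many limits are involved. The same [N] truncates the sum and indexes the
    limit. *)
Lemma tannery {R : realType} {u : nat -> nat -> R} {l B : nat -> R} {L : R} :
  (forall m N, `|u m N| <= B m) -> cvgn (series B) ->
  (forall m, u m @ \oo --> l m) -> series l @ \oo --> L ->
  (fun N => \sum_(0 <= m < N) u m N) @ \oo --> L.
Proof.
move=> uB cB ul lL.
have lB m : `|l m| <= B m.
  by apply: (ler_cvg_to (cvg_norm (ul m)) (cvg_cst (B m))); near=> N; exact: uB.
apply/cvgrPdist_le => e e0.
(* Two partial sums of [B] within e/12 of the limit differ by at most e/6; the tail of [l - u] costs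
   this twice, one of the three shares e/3. *)
have /cvgrPdist_le/(_ (e / 12)) : series B @ \oo --> limn (series B) by [].
case=> [|M _ hM]; first by lra.
have tailB N : (M <= N)%N -> \sum_(M <= m < N) B m <= e / 6.
  move=> MN; have := hM M (leqnn M); have := hM N MN.
  rewrite /series /= (@big_cat_nat _ _ _ M) //=.
  by rewrite !ler_norml => /andP[? ?] /andP[? ?]; lra.
have headu : (fun N => \sum_(0 <= m < M) (l m - u m N)) @ \oo --> (0 : R).
  rewrite [X in _ --> X](_ : _ = \sum_(0 <= m < M) (0 : R)); last by rewrite big1.
  apply: cvg_sum_seq => m; rewrite -(subrr (l m)).
  by apply: cvgB; [exact: cvg_cst | exact: ul].
near=> N.
have MN : (M <= N)%N by near: N; exists M.
have h1 : `|L - series l N| <= e / 3.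
  by near: N; move/cvgrPdist_le: lL; apply; lra.
have h2 : `|\sum_(0 <= m < M) (l m - u m N)| <= e / 3.
  by near: N; move/cvgr0Pnorm_le: headu; apply; lra.
have h3 : `|\sum_(M <= m < N) (l m - u m N)| <= e / 3.
  apply: (le_trans (ler_norm_sum _ _ _)).
  apply: (@le_trans _ _ (\sum_(M <= m < N) (B m + B m))).
    apply: ler_sum => m _; apply: (le_trans (ler_normB _ _)).
    by rewrite lerD.
  by rewrite big_split /=; have := tailB N MN; lra.
have -> : L - \sum_(0 <= m < N) u m N = (L - series l N) +
    (\sum_(0 <= m < M) (l m - u m N) + \sum_(M <= m < N) (l m - u m N)).
  by rewrite -big_cat_nat //= sumrB /series /=; ring.
apply: (le_trans (ler_normD _ _)).
by have := ler_normD (\sum_(0 <= m < M) (l m - u m N)) (\sum_(M <= m < N) (l m - u m N)); lra.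
Unshelve. all: by end_near.
Qed.

(** * Uniqueness of power series coefficients *)

Lemma sum_geom_le2 {R : realType} (t : R) (N : nat) :
  0 <= t -> t <= 1 / 2 -> \sum_(0 <= i < N) t ^+ i <= 2.
Proof.
move=> t0 t1; elim: N => [|N IH]; first by rewrite big_geq.
rewrite big_nat_recl //=; under eq_bigr do rewrite exprS.
rewrite -mulr_sumr expr0.
have : 0 <= \sum_(0 <= i < N) t ^+ i by apply: sumr_ge0 => i _; exact: exprn_ge0.
by nra.
Qed.

(** Convergence at a point w > 0 bounds |c_k| w^k by some C. If the coefficients below n vanish,
    then at t w the term of index n is cancelled by a tail of order t^(n+1); dividing by t^n and
    taking t small forces c_n = 0. *)
Lemma power_series_eq0 {R : realType} (c : nat -> R) :
  (\forall v \near (0 : R), series (fun n => c n * v ^+ n) @ \oo --> (0 : R)) ->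
  forall n, c n = 0.
Proof.
move=> [e /= e0 he].
have hser v : `|v| < e -> series (fun n => c n * v ^+ n) @ \oo --> (0 : R).
  by move=> ve; apply: he; rewrite /= sub0r normrN.
pose w := e / 2; have w0 : 0 < w by rewrite /w; lra.
have [C C0 hC] : exists2 C, 0 < C & forall k, `|c k| * w ^+ k <= C.
  have /cvg_series_bounded : cvgn (series (fun n => c n * w ^+ n)).
    by apply/cvg_ex; exists 0; apply: hser; rewrite gtr0_norm // /w; lra.
  move=> /pinfty_ex_gt0[C C0 hC]; exists C => // k.
  by have := hC k I; rewrite /= normrM normrX (gtr0_norm w0).
elim/ltn_ind => n IH.
have key t : 0 < t -> t <= 1 / 2 -> `|c n| * w ^+ n <= 2 * C * t.
  move=> t0 t1.
  have tw0 : 0 < t * w by exact: mulr_gt0.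
  (* The 0 is the limit of the full partial sums; the other summand bounds the tail, whose geometric
     factor is at most 2 since t <= 1/2. *)
  suff : `|c n| * (t * w) ^+ n <= 0 + C * (2 * t ^+ n.+1).
    rewrite exprMn exprS => h.
    have tn : 0 < t ^+ n by exact: exprn_gt0.
    rewrite -(ler_pM2r tn); apply: le_trans (le_trans h _); last by lra.
    by rewrite le_eqVlt; apply/orP; left; apply/eqP; ring.
  have cN : series (fun k => c k * (t * w) ^+ k) @ \oo --> (0 : R).
    by apply: hser; rewrite gtr0_norm // /w; nra.
  have cN' : (fun N => `|series (fun k => c k * (t * w) ^+ k) N|
      + C * (2 * t ^+ n.+1)) @ \oo --> 0 + C * (2 * t ^+ n.+1).
    apply: cvgD; last exact: cvg_cst.
    by rewrite -[X in _ --> X](@normr0 _ R); exact: (cvg_norm cN).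
  have cc : (fun _ : nat => `|c n| * (t * w) ^+ n) @ \oo -->
      `|c n| * (t * w) ^+ n by exact: cvg_cst.
  apply: (ler_cvg_to cc cN'); near=> N.
  have nN : (n < N)%N by near: N; exists n.+1.
  have -> : `|c n| * (t * w) ^+ n = `|c n * (t * w) ^+ n|.
    by rewrite normrM normrX (gtr0_norm tw0).
  have -> : c n * (t * w) ^+ n = series (fun k => c k * (t * w) ^+ k) N
      - \sum_(n.+1 <= k < N) c k * (t * w) ^+ k.
    rewrite /series /= (@big_cat_nat _ _ _ n.+1) //= big_nat_recr //= big1_seq.
      by ring.
    by move=> i /andP[_]; rewrite mem_index_iota => /andP[_ iN]; rewrite IH // mul0r.
  apply: (le_trans (ler_normB _ _)); rewrite lerD2l.
  apply: (le_trans (ler_norm_sum _ _ _)).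
  apply: (@le_trans _ _ (\sum_(n.+1 <= k < N) C * t ^+ k)).
    apply: ler_sum => k _; rewrite normrM normrX (gtr0_norm tw0) exprMn.
    by rewrite mulrCA mulrC ler_pM2r ?exprn_gt0.
  rewrite -mulr_sumr ler_pM2l // -{1}[n.+1]add0n big_addn.
  under eq_bigr do rewrite exprD.
  by rewrite -mulr_suml ler_pM2r ?exprn_gt0 // sum_geom_le2 // ltW.
apply/normr0_eq0/eqP; apply: contraT => cn0.
pose y := `|c n| * w ^+ n.
have y0 : 0 < y by rewrite mulr_gt0 ?exprn_gt0 // lt_def cn0 normr_ge0.
have yC : y <= C by exact: hC.
(* This t turns the bound 2 C t into y / 2, contradicting y > 0; it is at most 1/4 because y <=
   C. *)
have := key (y / (4 * C)); rewrite divr_gt0 //; last by rewrite mulr_gt0.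
move=> /(_ isT).
rewrite ler_pdivrMr ?mulr_gt0 //.
have -> : 2 * C * (y / (4 * C)) = y / 2 by field; rewrite gt_eqF.
by rewrite -/y => h; have := h ltac:(lra); lra.
Unshelve. all: by end_near.
Qed.

Lemma sum_nat_from {R : realType} (F : nat -> R) (r N : nat) :
  (forall n, (n < r)%N -> F n = 0) ->
  \sum_(r <= n < N) F n = \sum_(0 <= n < N) F n.
Proof.
move=> F0; have [rN|Nr] := leqP r N.
  rewrite [RHS](@big_cat_nat _ _ _ r) //= [X in X + _]big1_seq ?add0r //.
  by move=> i /andP[_]; rewrite mem_index_iota => /andP[_ ?]; exact: F0.
rewrite big_geq ?(ltnW Nr) // big1_seq // => i /andP[_].
by rewrite mem_index_iota => /andP[_ iN]; rewrite F0 // (ltn_trans iN).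
Qed.

(** Makes the choice in [egf_coef] computable: two expansions of [f] differ by a power series that
    sums to 0 near 0. *)
Lemma egf_coef_unique {R : realType} (r : nat) (a : nat -> R) (f : R -> R) :
  has_egf_from r a f -> egf_coef r f = a.
Proof.
move=> [a0 af]; apply: xget_unique; first by split.
move=> b [b0 bf]; apply/funext => n.
suff h : (b n - a n) / n`!%:R = 0.
  apply/eqP; rewrite -subr_eq0; move/eqP: h; rewrite mulf_eq0 => /orP[//|].
  by rewrite invr_eq0 pnatr_eq0 eqn0Ngt fact_gt0.
move: n; apply: power_series_eq0.
near=> v.
have hb : (fun N : nat => \sum_(r <= n < N) b n * (v ^+ n / n`!%:R)) @ \oo --> f v.
  by near: v.
have ha : (fun N : nat => \sum_(r <= n < N) a n * (v ^+ n / n`!%:R)) @ \oo --> f v.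
  by near: v.
rewrite -(subrr (f v)).
apply: cvg_seq_ext (cvgB hb ha) _ => N.
transitivity (\sum_(r <= n < N) (b n - a n) / n`!%:R * v ^+ n).
  by rewrite -[LHS]sumrB; apply: eq_bigr => n _; ring.
by rewrite sum_nat_from // => n nr; rewrite a0 // b0 // subrr !mul0r.
Unshelve. all: by end_near.
Qed.

(** * Stirling numbers of the second kind *)

Fixpoint stirl2 (n m : nat) : nat :=
  match n, m with
  | 0, 0 => 1
  | n'.+1, m'.+1 => m'.+1 * stirl2 n' m'.+1 + stirl2 n' m'
  | _, _ => 0
  end%N.

Lemma stirl2_small (n m : nat) : (n < m)%N -> stirl2 n m = 0%N.
Proof.
elim: n m => [|n IH] [|m] //= nm.
by rewrite !IH ?muln0 // (ltn_trans _ nm).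
Qed.

(** Inclusion-exclusion count of surjections, obtained by induction from the recurrence. Its powers
    (m - i)^n are the coefficients of exponentials, which gives access to the generating
    function. *)
Lemma stirl2_explicit {R : realType} (n m : nat) :
  m`!%:R * (stirl2 n m)%:R
  = \sum_(0 <= i < m.+1) (-1) ^+ i * 'C(m, i)%:R * (m - i)%:R ^+ n :> R.
Proof.
elim: n m => [|n IH] [|m].
- by rewrite big_nat1 /= !mulr1.
(* For n = 0 every power is 1, including 0^0 in the last term, so the sum is a full binomial
   expansion. *)
- transitivity ((1 - 1 : R) ^+ m.+1); first by rewrite subrr expr0n /= mulr0.
  rewrite exprBn big_mkord.
  by apply: eq_bigr => i _; rewrite !expr1n !mulr1 mulr_natr.
- by rewrite big_nat1 /= subnn exprS mul0r !mulr0.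
rewrite [stirl2 _ _]/= natrD natrM mulrDr mulrCA IH factS natrM -!mulrA IH.
rewrite -mulrDr [X in _ * (_ + X)](_ : _ = - \sum_(0 <= i < m.+1)
    (-1) ^+ i.+1 * 'C(m, i)%:R * (m.+1 - i.+1)%:R ^+ n); last first.
  by rewrite -sumrN; apply: eq_bigr => i _; rewrite subSS exprS; ring.
rewrite [X in _ * (X - _)]big_nat_recl // [RHS]big_nat_recl // -addrA -sumrB.
rewrite mulrDr mulr_sumr !subn0; congr (_ + _).
  by rewrite !bin0 !expr0 !mul1r exprS.
apply: eq_bigr => i _.
(* Pascal's rule leaves (m+1) C(m, i+1), which equals (m+1 - (i+1)) C(m+1, i+1): the extra factor
   raises the power from n to n+1. *)
have /(congr1 (fun k : nat => k%:R : R)) := mul_bin_down m.+1 i.+1.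
rewrite /= !natrM binS natrD !exprS.
move: (m.+1 - i.+1)%:R ((m.+1 - i.+1)%:R ^+ n) => X Xn h.
transitivity (- (-1) ^+ i * (m.+1%:R * 'C(m, i.+1)%:R) * Xn); first by ring.
by rewrite h; ring.
Qed.

Lemma cvg_series_expR {R : realType} (v : R) :
  series (fun n => v ^+ n / n`!%:R) @ \oo --> expR v.
Proof. exact: is_cvg_series_exp_coeff. Qed.

(** The binomial theorem writes (e^v - 1)^m as a finite combination of exponentials e^((m-i)v);
    their series are added term by term. *)
Lemma cvg_stirl2_series {R : realType} (m : nat) (v : R) :
  series (fun n => (stirl2 n m)%:R * (v ^+ n / n`!%:R)) @ \oo -->
  (expR v - 1) ^+ m / m`!%:R.
Proof.
have fm : m`!%:R != 0 :> R by rewrite pnatr_eq0 -lt0n fact_gt0.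
have -> : (expR v - 1) ^+ m / m`!%:R = \sum_(0 <= i < m.+1)
    (-1) ^+ i * 'C(m, i)%:R / m`!%:R * expR ((m - i)%:R * v).
  rewrite exprBn big_mkord mulr_suml; apply: eq_bigr => i _.
  by rewrite expRM_natl expr1n mulr1 -mulr_natr; ring.
have h : (fun N => \sum_(0 <= i < m.+1) (-1) ^+ i * 'C(m, i)%:R / m`!%:R *
      series (fun n => ((m - i)%:R * v) ^+ n / n`!%:R) N) @ \oo -->
    \sum_(0 <= i < m.+1) (-1) ^+ i * 'C(m, i)%:R / m`!%:R * expR ((m - i)%:R * v).
  by apply: cvg_sum_seq => i; apply: cvgMl_tmp; exact: cvg_series_expR.
apply: cvg_seq_ext h _ => N.
rewrite /series /=; under eq_bigr do rewrite mulr_sumr.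
rewrite exchange_big /=; apply: eq_bigr => n _.
transitivity (m`!%:R^-1 * (m`!%:R * (stirl2 n m)%:R) * (v ^+ n / n`!%:R)); last first.
  by rewrite mulKf.
rewrite stirl2_explicit mulr_sumr mulr_suml; apply: eq_bigr => i _.
by rewrite exprMn; ring.
Qed.

Lemma stirling2E {R : realType} (n m : nat) : stirling2 R n m = (stirl2 n m)%:R.
Proof.
rewrite /stirling2 (@egf_coef_unique R m (fun n => (stirl2 n m)%:R)) //.
split=> [k km|]; first by rewrite stirl2_small.
near=> v.
apply: cvg_seq_ext (cvg_stirl2_series m v) _ => N.
by rewrite sum_nat_from // => k km; rewrite stirl2_small // mul0r.
Unshelve. all: by end_near.
Qed.

(** * Touchard polynomials and shifted exponential generating functions *)

Definition touchard {R : realType} (b : R) (n : nat) : R :=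
  \sum_(0 <= m < n.+1) b ^+ m * (stirl2 n m)%:R.

Lemma cvg_touchard_series {R : realType} (b v : R) :
  series (fun n => touchard b n * (v ^+ n / n`!%:R)) @ \oo -->
  expR (b * (expR v - 1)).
Proof.
pose u m N : R := b ^+ m * \sum_(0 <= n < N) (stirl2 n m)%:R * (v ^+ n / n`!%:R).
(* Since S(n, m) = 0 for m > n, the rows n < N involve only columns m < N, so the partial sum has
   the form that [tannery] requires. *)
rewrite [X in X @ _](_ : _ = fun N => \sum_(0 <= m < N) u m N); last first.
  apply/funext => N; rewrite /series /=.
  under [RHS]eq_bigr do rewrite /u mulr_sumr.
  rewrite exchange_big_nat /=; apply: eq_big_nat => n /andP[_ nN].
  rewrite (@big_cat_nat _ _ _ n.+1) //= [X in _ + X]big1_seq ?addr0; last first.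
    move=> m /andP[_]; rewrite mem_index_iota => /andP[nm _].
    by rewrite stirl2_small // mul0r mulr0.
  by rewrite /touchard mulr_suml; apply: eq_bigr => m _; exact: esym (mulrA _ _ _).
(* The partial sums of column m at |v| increase to w^m / m!, so this bounds them for all N at once;
   the resulting majorants sum to exp(|b| w). *)
pose w := expR `|v| - 1.
apply: (@tannery _ u (fun m => b ^+ m * ((expR v - 1) ^+ m / m`!%:R))
  (fun m => `|b| ^+ m * (w ^+ m / m`!%:R))).
- move=> m N; rewrite normrM normrX ler_wpM2l ?exprn_ge0 //.
  apply: (le_trans (ler_norm_sum _ _ _)).
  have -> : \sum_(0 <= n < N) `|(stirl2 n m)%:R * (v ^+ n / n`!%:R)| =
      series (fun n => (stirl2 n m)%:R * (`|v| ^+ n / n`!%:R)) N.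
    by apply: eq_bigr => n _; rewrite !normrM normfV normrX !normr_nat.
  have cv := cvg_stirl2_series m `|v|.
  rewrite /w -(cvg_lim _ cv) //; apply: nondecreasing_cvgn_le.
    apply: nondecreasing_series => n _ _.
    by rewrite !mulr_ge0 ?exprn_ge0 ?invr_ge0.
  by apply/cvg_ex; eexists; exact: cv.
- apply/cvg_ex; exists (expR (`|b| * w)).
  apply: cvg_seq_ext (cvg_series_expR (`|b| * w)) _ => N.
  by apply: eq_bigr => n _; rewrite exprMn -mulrA.
- by move=> m; apply: cvgMl_tmp; exact: cvg_stirl2_series.
- apply: cvg_seq_ext (cvg_series_expR (b * (expR v - 1))) _ => N.
  by apply: eq_bigr => n _; rewrite exprMn -mulrA.
Qed.

(** The factor v^r shifts the coefficients by r, and n! / (r! (n-r)!) is the binomial coefficient,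
    which also supplies the zeros below r. *)
Lemma has_egf_from_scale {R : realType} (r : nat) (c : R) (a : nat -> R)
    (f : R -> R) :
  (forall v, series (fun n => a n * (v ^+ n / n`!%:R)) @ \oo --> f v) ->
  has_egf_from r (fun n => 'C(n, r)%:R * c ^+ r * a (n - r)%N)
    (fun v => (v * c) ^+ r / r`!%:R * f v).
Proof.
move=> af; split=> [n nr|]; first by rewrite bin_small // !mul0r.
near=> v.
have h : (fun N => (v * c) ^+ r / r`!%:R *
    series (fun n => a n * (v ^+ n / n`!%:R)) N) @ \oo -->
    (v * c) ^+ r / r`!%:R * f v by apply: cvgMl_tmp; exact: af.
(* The partial sum up to N of the product matches the one up to N - r of the original series. *)
rewrite -(cvg_centern r) in h; apply: cvg_seq_ext h _ => N.
rewrite /series /= mulr_sumr -[RHS]/(\sum_(0 + r <= n < N) _) big_addn.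
apply: eq_bigr => n _; rewrite addnK.
have /(congr1 (fun k : nat => k%:R : R)) := @bin_fact (n + r) r (leq_addl _ _).
rewrite addnK !natrM => <-.
have fn k : k`!%:R != 0 :> R by rewrite pnatr_eq0 -lt0n fact_gt0.
have C0 : 'C(n + r, r)%:R != 0 :> R by rewrite pnatr_eq0 -lt0n bin_gt0 leq_addl.
by rewrite exprMn exprD; field; rewrite !fn C0.
Unshelve. all: by end_near.
Qed.

(** * The q-number identity and the Poisson moment generating function *)

Lemma qnum_1B {R : realType} (q x : R) : 0 < q -> q < 1 ->
  qnum q (1 - x) = 1 - qnum q^-1 x.
Proof.
move=> q0 q1; rewrite /qnum.
have -> : q^-1 `^ x = q `^ (- x) by rewrite powRN -powR_inv1 ?ltW// -powRrM mulN1r powRN.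
have -> : q `^ (1 - x) = q * q `^ (- x).
  by rewrite powRD ?powRr1 ?ltW //; apply/implyP => _; rewrite gt_eqF.
field; apply/and3P; split; first by rewrite gt_eqF.
  by apply/eqP => h; lra.
by apply/eqP => h; lra.
Qed.

Lemma mmt_gen_fun_poisson {d : measure_display} {T : measurableType d}
    {R : realType} {P : probability T R} {Y : {RV P >-> R}} {alpha : R} (v : R) :
  is_poisson Y alpha -> 'M_P Y v = (expR (alpha * (expR v - 1)))%:E.
Proof.
move=> hY.
pose A (y : nat) := [set t | Y t = y%:R].
have mA y : measurable (A y).
  by rewrite (_ : A y = Y @^-1` [set y%:R]) //; exact: measurable_funPTI.
have tA : trivIset setT A.
  apply/trivIsetP => i j _ _ /eqP ij; rewrite -subset0 => t [ti tj]; apply: ij.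
  by apply/eqP; rewrite -(eqr_nat R) -(ti : Y t = _) -(tj : Y t = _).
have eseriesE (f : nat -> R) (L : R) : series f @ \oo --> L ->
    (\sum_(0 <= y <oo) (f y)%:E)%E = L%:E.
  move=> fL; apply/cvg_lim => //.
  rewrite (_ : (fun _ => _) = EFin \o series f); last first.
    by apply/funext => N; rewrite /= sumEFin.
  exact: (cvg_comp _ _ fL).
have mU : measurable (\bigcup_y A y) by exact: bigcup_measurable.
(* [is_poisson] prescribes only the masses of the atoms; as these sum to 1, the values of [Y]
   outside the naturals have probability 0. *)
have PU : P (\bigcup_y A y) = 1%E.
  rewrite measure_semi_bigcup //.
  transitivity (\sum_(0 <= y <oo) (expR (- alpha) * alpha ^+ y / y`!%:R)%:E)%E.
    by apply: eq_eseriesr => y _; exact: hY.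
  apply: eseriesE; rewrite [X in _ --> X](_ : _ = expR (- alpha) * expR alpha); last first.
    by rewrite -expRD addNr expR0.
  apply: cvg_seq_ext (cvgMl_tmp (cvg_series_expR alpha)) _ => N.
  by rewrite /series /= mulr_sumr; apply: eq_bigr => n _; rewrite mulrA.
have PUC : P (~` \bigcup_y A y) = 0%E by rewrite probability_setC // PU subee.
have mf (D : set T) : measurable D ->
    measurable_fun D (EFin \o (expR \o v \o* Y)).
  move=> mD; apply: measurable_funTS; apply/measurable_EFinP.
  by apply: measurableT_comp => //; exact: measurable_funM.
have f0 (D : set T) t : D t -> (0 <= ((expR \o v \o* Y) t)%:E)%E.
  by rewrite lee_fin expR_ge0.
(* The null complement contributes nothing, and on [A y] the integrand is the constant (e^v)^y, so
   the integral becomes an exponential series in alpha e^v. *)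
rewrite /mmt_gen_fun unlock -(setUv (\bigcup_y A y)).
have mUC := measurableC mU.
have disjU : [disjoint \bigcup_y A y & ~` \bigcup_y A y].
  by apply/disj_setPS; rewrite setICr.
rewrite (ge0_integral_setU _ mU mUC (mf _ (measurableU _ _ mU mUC)) (f0 _) disjU).
rewrite (null_set_integral mUC (mf _ mUC) PUC) adde0.
rewrite (ge0_integral_bigcup _ mA (mf _ mU) (f0 _) tA).
have -> : expR (alpha * (expR v - 1)) = expR (- alpha) * expR (alpha * expR v).
  by rewrite -expRD; congr expR; ring.
transitivity (\sum_(0 <= y <oo)
    (expR v ^+ y * (expR (- alpha) * alpha ^+ y / y`!%:R))%:E)%E.
  apply: eq_eseriesr => y _; rewrite (eq_integral (cst (expR v ^+ y)%:E)).
    by rewrite integral_cst // EFinM; congr (_ * _)%E; exact: hY.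
  by move=> t; rewrite inE => Yt; rewrite /= (Yt : Y t = _) expRM_natl.
apply: eseriesE.
apply: cvg_seq_ext (cvgMl_tmp (cvg_series_expR (alpha * expR v))) _ => N.
by rewrite /series /= mulr_sumr; apply: eq_bigr => n _; rewrite exprMn; ring.
Qed.

Theorem theorem3p2 (R : realType) (d : measure_display) (T : measurableType d)
    (P : probability T R) (Y : {RV P >-> R}) (alpha q x : R) (n r : nat)
    (halpha : 0 < alpha) (hY : is_poisson Y alpha)
    (hq0 : 0 < q) (hq1 : q < 1) (hx0 : 0 <= x) (hx1 : x <= 1)
    (hrn : (r <= n)%N) :
  prob_qBernstein Y r n x q =
  \sum_(0 <= m < (n - r).+1)
    'C(n, r)%:R * alpha ^+ m * (qnum q x) ^+ r * (1 - qnum q^-1 x) ^+ m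
      * stirling2 R (n - r) m.
Proof.
have egf := has_egf_from_scale r (qnum q x) _ _
  (cvg_touchard_series (alpha * qnum q (1 - x))).
rewrite /prob_qBernstein [X in egf_coef r X](_ : _ = fun v =>
    (v * qnum q x) ^+ r / r`!%:R *
    expR (alpha * qnum q (1 - x) * (expR v - 1))); last first.
  (* The moment generating function is finite and an exponential, so [fine] disappears and the real
     power multiplies the exponent. *)
  apply/funext => v; rewrite (mmt_gen_fun_poisson _ hY) /= -expRM.
  by congr (_ * expR _); ring.
rewrite (egf_coef_unique _ _ _ egf) qnum_1B // /touchard mulr_sumr.
move: (1 - qnum q^-1 x) => z.
by apply: eq_bigr => m _; rewrite stirling2E [(alpha * z) ^+ m]exprMn; ring.
Qed.
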